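(* For every finite simple graph $G$, $\pi^{c}(G)\ge \pi^{*}(G)$. Moreover, equality $\pi^{c}(G)=\pi^{*}(G)$ holds whenever $G$ is a tree or a cycle.
   Context: A configuration of cops (pebbles) on a graph $G$ is a function $C:V(G)\to\mathbb{Z}_{\ge 0}$ of size $|C|=\sum_{v}C(v)$. A pebbling step from a vertex $u$ with $C(u)\ge 2$ to an adjacent vertex $v$ removes two pebbles from $u$ and adds one pebble to $v$. The optimal pebbling number $\pi^{*}(G)$ is the minimum $m$ such that there is a configuration of size $m$ from which, for every target vertex $t$, some sequence of pebbling steps places at least one pebble on $t$. In the cops and robbers pebbling game, cops are placed according to a configuration $C$, then a robber chooses a starting vertex; thereafter, in each turn the cops make pebbling steps, after which the robber either moves to an adjacent vertex or stays put. The robber is captured when he occupies a vertex holding at least one cop. The cop pebbling number $\pi^{c}(G)$ is the minimum $m$ such that some configuration of size $m$ allows the cops to capture the robber regardless of how he starts and moves. *)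

(* Defs.v *)
From mathcomp Require Import all_boot.
From mathcomp Require Import boolp.
From Stdlib Require Import Relations.Relation_Operators.

Set Implicit Arguments.
Unset Strict Implicit.
Unset Printing Implicit Defensive.

Record sgraph := SGraph {
  vertex :> finType;
  adj : rel vertex;
  adj_sym : symmetric adj;
  adj_irrefl : irreflexive adj }.

Definition is_tree (G : sgraph) : Prop :=
  [/\ 0 < #|G|,
      forall x y : G, connect (@adj G) x y &
      forall c : seq G, 2 < size c -> ~ ucycle (@adj G) c].

(* [G] is isomorphic to C_n for some n >= 3; [ordS] is the cyclic successor. *)
Definition is_cycle (G : sgraph) : Prop :=
  exists n : nat, 2 < n /\
    exists f : 'I_n -> G, bijective f /\
      forall i j : 'I_n, adj (f i) (f j) = (j == ordS i) || (i == ordS j).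

Definition config (G : sgraph) := {ffun G -> nat}.

Definition csize (G : sgraph) (C : config G) : nat := \sum_v C v.

Definition pebbling_step (G : sgraph) (C C' : config G) : Prop :=
  exists u v : G, [/\ adj u v, 2 <= C u &
    C' = [ffun w => C w - 2 * (w == u) + (w == v)]].

Definition pebbling_reaches (G : sgraph) : config G -> config G -> Prop :=
  clos_refl_trans (config G) (@pebbling_step G).

Definition solvable (G : sgraph) (C : config G) : Prop :=
  forall t : G, exists C' : config G, pebbling_reaches C C' /\ 0 < C' t.

(* One turn of the cops: [s u v] pebbling steps are made simultaneously from
   [u] to [v], so each cop travels along at most one edge per turn: the cops
   spent at [u] must be on [u] at the start of the turn.  (If arriving cops
   could move on within the same turn, the cops could capture a robber on any
   vertex reachable from [C] at once.)  Making no step is allowed. *)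
Definition cop_turn (G : sgraph) (C C' : config G) : Prop :=
  exists s : G -> G -> nat,
    [/\ forall u v, 0 < s u v -> adj u v,
        forall u, 2 * (\sum_v s u v) <= C u &
        forall w, C' w = C w - 2 * (\sum_v s w v) + \sum_u s u w].

(* The cops, to move with the robber on [r], can force a capture in finitely
   many turns, seeing the robber's position before each of their turns. *)
Inductive cops_win (G : sgraph) : config G -> G -> Prop :=
| cops_win_captured (C : config G) (r : G) : 0 < C r -> cops_win C r
| cops_win_catch (C C' : config G) (r : G) : cop_turn C C' -> 0 < C' r -> cops_win C r
| cops_win_turn (C C' : config G) (r : G) : cop_turn C C' ->
    (forall r', (r' == r) || adj r r' -> cops_win C' r') -> cops_win C r.

Definition cop_winning (G : sgraph) (C : config G) : Prop :=
  forall r : G, cops_win C r.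

Lemma solvable_exists (G : sgraph) :
  exists m, `[< exists C : config G, csize C = m /\ solvable C >].
Proof.
exists (csize [ffun _ : G => 1]); apply/asboolP.
exists [ffun=> 1]; split=> // t; exists [ffun=> 1].
by split; [apply: rt_refl | rewrite ffunE].
Qed.

Lemma cop_winning_exists (G : sgraph) :
  exists m, `[< exists C : config G, csize C = m /\ cop_winning C >].
Proof.
exists (csize [ffun _ : G => 1]); apply/asboolP.
exists [ffun=> 1]; split=> // r.
by apply: cops_win_captured; rewrite ffunE.
Qed.

Definition optimal_pebbling_number (G : sgraph) : nat :=
  ex_minn (solvable_exists G).

Definition cop_pebbling_number (G : sgraph) : nat :=
  ex_minn (cop_winning_exists G).

(* Main.v *)
(* A sequence of pebbling steps is recorded by the number [s u v] of steps from
   [u] to [v]; it can only put a pebble on [t] if every vertex is balanced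
   ([flow_solves]).

   Lower bound: a robber who never moves is caught only if his vertex can be
   reached.

   Trees: every solvable configuration wins.  Call free the vertices that the
   robber can reach without meeting a cop; the cops keep all of them solvable.
   They make a single step [u -> p] along the path from some [u] with two cops to
   the robber.  The new cop on [p] shields everything behind the edge [u p], and
   for the other free targets the step goes in the right direction: if a
   solution does not use it, what the solution does behind that edge is useless.

   Cycles: two cops on every third vertex (and one more cop on the last vertex if
   [n = 1 %[mod 3]]) catch the robber in one turn, so it remains to see that a
   solvable [C] has [2 n <= 3 |C|].  Opposite steps cancel, so each empty vertex
   is reached by a purely clockwise or purely anticlockwise flow.  The pointwise
   maximum of clockwise flows is one, and a potential argument along it shows
   that a pile of [k > 0] pebbles pays for at most [(3 k - 2) / 4] empty vertices
   in each direction, hence for [3 k / 2] vertices in total. *)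
Require Import Defs.
From mathcomp Require Import all_boot.
From mathcomp Require Import boolp zify.
From Stdlib Require Import Relations.Relation_Operators.
From Stdlib Require Import Relations.Operators_Properties.

Set Implicit Arguments.
Unset Strict Implicit.
Unset Printing Implicit Defensive.

(** * Cop turns, sequences of steps, and flows *)

Section Flows.

Variable G : sgraph.
Implicit Types (C : config G) (s : G -> G -> nat) (u v w t r : G).

Definition unit_step u v : G -> G -> nat :=
  fun x y => (x == u) && (y == v).

Lemma out_unit_step u v w : \sum_y unit_step u v w y = (w == u).
Proof.
rewrite /unit_step (bigD1 v) //= eqxx andbT big1 ?addn0 // => y /negbTE->.
by rewrite andbF.
Qed.

Lemma in_unit_step u v w : \sum_x unit_step u v x w = (w == v).
Proof.
by rewrite /unit_step (bigD1 u) //= eqxx big1 ?addn0 // => y /negbTE->.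
Qed.

Lemma split_unit_step s u v : 0 < s u v ->
  exists s', forall x y, s x y = s' x y + unit_step u v x y.
Proof.
move=> s_gt0; exists (fun x y => s x y - unit_step u v x y) => x y.
by rewrite subnK // /unit_step; case: eqP => // ->; case: eqP => // ->.
Qed.

Lemma out_split s s' u v w :
  (forall x y, s x y = s' x y + unit_step u v x y) ->
  \sum_y s w y = \sum_y s' w y + (w == u).
Proof.
by move=> sE; rewrite -(out_unit_step u v) -big_split; apply: eq_bigr.
Qed.

Lemma in_split s s' u v w :
  (forall x y, s x y = s' x y + unit_step u v x y) ->
  \sum_x s x w = \sum_x s' x w + (w == v).
Proof.
by move=> sE; rewrite -(in_unit_step u v) -big_split; apply: eq_bigr.
Qed.

Lemma step_cop_turn C C' : pebbling_step C C' -> cop_turn C C'.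
Proof.
move=> [u [v [uv C_u ->]]]; exists (unit_step u v); split=> [x y|x|x].
- by rewrite /unit_step; case: eqP => // ->; case: eqP => // ->.
- by rewrite out_unit_step; case: eqP => // ->.
- by rewrite out_unit_step in_unit_step ffunE.
Qed.

Lemma csize_step C C' : pebbling_step C C' -> csize C = (csize C').+1.
Proof.
move=> [u [v [_ C_u ->]]].
have sum1 (x : G) : \sum_w (w == x) = 1.
  by rewrite (bigD1 x) //= eqxx big1 // => w /negbTE->.
set D := finfun _.
have : csize C + \sum_w (w == v) = csize D + \sum_w 2 * (w == u).
  rewrite /csize -!big_split /=; apply: eq_bigr => w _.
  by rewrite ffunE; case: (w =P u) => [->|]; lia.
by rewrite -big_distrr /= !sum1; lia.
Qed.

(** The steps of a turn can be played one by one in any order: each is paid with cops that stood on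
    its source from the start, and arriving cops only add. *)
Lemma cop_turn_reaches C C' : cop_turn C C' -> pebbling_reaches C C'.
Proof.
move=> [s [s_adj s_le C'E]].
have [k le_k] := ubnP (\sum_u \sum_v s u v).
elim: k => // k IHk in s C s_adj s_le C'E le_k *.
case: (pselect (exists u v, 0 < s u v)) => [[u [v s_uv]]|s0]; last first.
  have {}s0 x y : s x y = 0.
    by apply/eqP; rewrite -leqn0 leqNgt; apply/negP => sxy; case: s0; exists x, y.
  have -> : C' = C; last exact: rt_refl.
  by apply/ffunP => w; rewrite C'E !big1 ?subn0 ?addn0.
have [s' sE] := split_unit_step s_uv.
pose C1 : config G := [ffun w => C w - 2 * (w == u) + (w == v)].
have s_leE w : 2 * (\sum_y s' w y + (w == u)) <= C w.
  by rewrite -(out_split _ sE).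
apply: (@rt_trans _ _ _ C1).
  apply: rt_step; exists u, v; split=> //; first exact: s_adj.
  by have := s_leE u; rewrite eqxx; lia.
apply: (IHk s') => [x y s'xy|w|w|].
- by apply: s_adj; rewrite sE; lia.
- by rewrite ffunE; have := s_leE w; lia.
- rewrite ffunE C'E (out_split _ sE) (in_split _ sE).
  by have := s_leE w; lia.
- have : \sum_x \sum_y s x y = \sum_x \sum_y s' x y + 1.
    under eq_bigr => x _ do rewrite (out_split _ sE).
    rewrite big_split /=; congr (_ + _).
    by rewrite (bigD1 u) //= eqxx big1 // => w /negbTE->.
  by lia.
Qed.

Lemma cops_win_reaches C r :
  cops_win C r -> exists C', pebbling_reaches C C' /\ 0 < C' r.
Proof.
elim=> {C r} [C r Cr|C C' r CC' C'r|C C' r CC' _ IH].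
- by exists C; split=> //; apply: rt_refl.
- by exists C'; split=> //; apply: cop_turn_reaches.
- have [|C'' [C'C'' C''r]] := IH r; first by rewrite eqxx.
  exists C''; split=> //; apply: rt_trans C'C''; exact: cop_turn_reaches.
Qed.

Lemma cop_winning_solvable C : cop_winning C -> solvable C.
Proof. by move=> win t; apply: cops_win_reaches. Qed.

Definition flow_solves C t : Prop :=
  exists s, (forall u v, 0 < s u v -> adj u v) /\
    forall w, 2 * (\sum_v s w v) + (w == t) <= C w + \sum_u s u w.

Lemma reaches_flow_solves C C' t :
  pebbling_reaches C C' -> 0 < C' t -> flow_solves C t.
Proof.
move=> /clos_rt_rt1n_iff; elim=> {C C'} [C Ct|C C1 C' [u [v [uv Cu ->]]] _ IH C't].
  exists (fun _ _ => 0); split=> // w.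
  by rewrite !big1 // addn0; case: eqP => // ->.
have [s [s_adj s_bal]] := IH C't.
pose s1 x y := s x y + unit_step u v x y.
exists s1; split=> [x y|w].
  rewrite /s1 /unit_step; case: (x =P u) => [->|_] /=.
    by case: (y =P v) => [->//|_]; rewrite addn0; apply: s_adj.
  by rewrite addn0; apply: s_adj.
have s1E x y : s1 x y = s x y + unit_step u v x y by [].
rewrite (out_split _ s1E) (in_split _ s1E).
by have := s_bal w; rewrite ffunE; case: (w =P u) => [->|]; lia.
Qed.

(* If no vertex held two pebbles, then at each vertex at least as many steps
   would come in as go out, and at [t] strictly more. *)
Lemma flow_solves_two_pebbles C t :
  flow_solves C t -> C t = 0 -> exists u, 1 < C u.
Proof.
move=> [s [_ s_bal]] Ct; apply: contrapT => no_pair.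
have C_le1 w : C w <= 1.
  by rewrite leqNgt; apply/negP => Cw; apply: no_pair; exists w.
have : \sum_w (\sum_v s w v + (w == t)) <= \sum_w \sum_u s u w.
  apply: leq_sum => w _; have := s_bal w; have := C_le1 w.
  by case: (w =P t) => [->|_]; rewrite ?Ct; lia.
rewrite big_split /= [X in _ <= X]exchange_big /= [\sum_w (w == t)](bigD1 t) //= eqxx.
by lia.
Qed.

End Flows.

(** * Trees *)

Section Trees.

Variable G : sgraph.
Hypothesis treeG : is_tree G.
Implicit Types (C : config G) (u v w t r p x y : G) (D : {set G}).

Definition avoiding u x y : bool := [&& adj x y, x != u & y != u].
Arguments avoiding u x y /.

Lemma avoiding_sym u : connect_sym (avoiding u).
Proof.
apply: sym_connect_sym => x y /=.
by rewrite adj_sym; case: (adj y x) => //=; rewrite andbC.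
Qed.

Lemma avoiding_path u x q : path (avoiding u) x q -> x != u ->
  path (@adj G) x q /\ u \notin x :: q.
Proof.
elim: q x => [|y q IHq] x /=; first by move=> _; rewrite inE eq_sym.
move=> /andP[/and3P[xy xu yu] /IHq/(_ yu)[yq uq]] _; split; first by rewrite xy.
by rewrite inE negb_or eq_sym xu.
Qed.

Lemma path_avoiding u x q : path (@adj G) x q -> u \notin x :: q ->
  path (avoiding u) x q.
Proof.
elim: q x => //= y q IHq x /andP[xy yq]; rewrite inE negb_or => /andP[ux uyq].
rewrite IHq // andbT xy eq_sym ux /=.
by move: uyq; rewrite inE negb_or eq_sym => /andP[].
Qed.

(** Otherwise a simple path from [x] to [p] avoiding [u] closes up through [u] to a cycle. *)
Lemma tree_neighbor_unique u x p : adj u x -> adj u p ->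
  connect (avoiding u) x p -> x = p.
Proof.
case: treeG => _ _ acyclic ux up /connectP[q xq p_last].
apply: contrapT => x_p.
have x_u : x != u by apply: contraTneq ux => ->; rewrite adj_irrefl.
move: p_last; case: (shortenP xq) => q' xq' uniq_q' _ p_last.
have [adj_q' u_q'] := avoiding_path xq' x_u.
apply: (acyclic [:: u, x & q']).
  by case: q' p_last {xq' uniq_q' adj_q' u_q'} => //= xp; case: x_p.
apply/andP; split; last by rewrite cons_uniq u_q'.
by rewrite /= ux rcons_path adj_q' -p_last adj_sym.
Qed.

Lemma tree_cut u r : u != r -> exists p D,
  [/\ adj u p, p \in D, r \in D, u \notin D &
    forall x y, x \in D -> y \notin D -> adj x y -> x = p /\ y = u].
Proof.
move=> u_r; case: treeG => _ conn _.
have /connectP[q uq r_last] := conn u r; move: r_last.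
case: (shortenP uq) => -[|p q'] /= uq' uniq_q' _ r_last.
  by rewrite r_last eqxx in u_r.
move: uq' uniq_q' => /andP[up pq'] /andP[u_q' _].
have p_r : connect (avoiding u) p r.
  by apply/connectP; exists q' => //; apply: path_avoiding.
exists p, [set x | (x != u) && connect (avoiding u) r x]; split=> //.
- rewrite inE avoiding_sym p_r andbT eq_sym.
  by move: u_q'; rewrite inE negb_or => /andP[].
- by rewrite inE eq_sym u_r connect0.
- by rewrite inE eqxx.
move=> x y; rewrite !inE => /andP[x_u r_x]; rewrite negb_and negbK => y_D xy.
have y_u : y = u.
  apply/eqP; apply: contraTT y_D => y_u; rewrite negb_or y_u negbK /=.
  by apply: connect_trans r_x _; apply: connect1; rewrite /= xy x_u.
split=> //; apply: (@tree_neighbor_unique u) => //.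
  by rewrite -y_u adj_sym.
by rewrite avoiding_sym; apply: connect_trans r_x; exact: p_r.
Qed.

Lemma flow_solves_step C u p D t :
  1 < C u -> p \in D -> u \notin D -> t \in D ->
  (forall x y, x \in D -> y \notin D -> adj x y -> x = p /\ y = u) ->
  flow_solves C t ->
  flow_solves [ffun w => C w - 2 * (w == u) + (w == p)] t.
Proof.
move=> Cu pD uD tD cut [s [s_adj s_bal]].
case: (posnP (s u p)) => [s_up0|s_up]; last first.
  have [s' sE] := split_unit_step s_up.
  exists s'; split=> [x y s'xy|w]; first by apply: s_adj; rewrite sE; lia.
  have := s_bal w; rewrite (out_split _ sE) (in_split _ sE) ffunE.
  by case: (w =P u) => [->|]; lia.
exists (fun x y => if (x \in D) && (y \in D) then s x y else 0).
split=> [x y|w]; first by case: ifP => // _; apply: s_adj.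
case: (boolP (w \in D)) => wD; last first.
  have -> : (w == t) = false by apply: contraNF wD => /eqP->.
  by rewrite big1.
have w_u : (w == u) = false by apply: contraNF uD => /eqP <-.
have in_w : \sum_x (if (x \in D) && true then s x w else 0) = \sum_x s x w.
  apply: eq_bigr => x _; rewrite andbT; case: ifP => // /negbT xD.
  case: (posnP (s x w)) => // sxw; have := s_adj _ _ sxw.
  rewrite adj_sym => wx; have [wp xu] := cut _ _ wD xD wx.
  by rewrite wp xu s_up0 in sxw.
rewrite in_w ffunE w_u muln0 subn0.
have out_w : \sum_y (if true && (y \in D) then s w y else 0) <= \sum_y s w y.
  by apply: leq_sum => y _; case: ifP.
by have := s_bal w; lia.
Qed.

Definition free_edge C x y : bool := [&& adj x y, C x == 0 & C y == 0].
Arguments free_edge C x y /.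

(** Every step costs one cop, so the chase ends by induction on the size; the hypothesis is the
    invariant. *)
Lemma tree_cops_win C r :
  (forall t, connect (free_edge C) r t -> flow_solves C t) -> cops_win C r.
Proof.
have [k] := ubnP (csize C); elim: k => // k IHk in C r * => le_k solves.
case: (posnP (C r)) => [Cr|]; last exact: cops_win_captured.
have [u Cu] := flow_solves_two_pebbles (solves r (connect0 _ _)) Cr.
have u_r : u != r by apply: contraTneq Cu => ->; rewrite Cr.
have [p [D [up pD rD uD cut]]] := tree_cut u_r.
pose C' : config G := [ffun w => C w - 2 * (w == u) + (w == p)].
have step : pebbling_step C C' by exists u, p.
have turn := step_cop_turn step.
case: (posnP (C' r)) => [C'r|]; last exact: cops_win_catch turn.
apply: cops_win_turn turn _ => r' rr'.
case: (posnP (C' r')) => [C'r'|]; last exact: cops_win_captured.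
apply: IHk => [|t r't]; first by have := csize_step step; lia.
have {r't} : connect (free_edge C') r t.
  apply: connect_trans r't; case/orP: rr' => [/eqP->//|rr'].
  by apply: connect1; rewrite /= rr' C'r C'r'.
have C'D x : x \in D -> C' x = C x + (x == p).
  move=> xD; rewrite ffunE.
  have -> : (x == u) = false by apply: contraNF uD => /eqP <-.
  by rewrite muln0 subn0.
(* A free path cannot leave [D], since it would pass the occupied [p]; and counts inside [D] only
   grew, so it was free before the step. *)
suff free_D x : x \in D -> connect (free_edge C') x t ->
    t \in D /\ connect (free_edge C) x t.
  case/(free_D _ rD) => tD rt.
  by apply: (flow_solves_step (D := D)) => //; apply: solves.
move=> xD /connectP[q].
elim: q x xD => [x xD _ /= ->|y q IHq x xD]; first by split.
move=> /= /andP[/and3P[xy C'x C'y] yq] t_last.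
have yD : y \in D.
  apply: contraT => yD; have [xp _] := cut _ _ xD yD xy.
  by move: C'x; rewrite C'D // xp eqxx addn1.
have [tD yt] := IHq y yD yq t_last; split=> //.
apply: connect_trans yt; apply: connect1.
rewrite /= xy; move: C'x C'y; rewrite !C'D // !addn_eq0.
by move=> /andP[-> _] /andP[-> _].
Qed.

Lemma tree_solvable_cop_winning C : solvable C -> cop_winning C.
Proof.
move=> sol r; apply: tree_cops_win => t _.
by have [C' [CC' C't]] := sol t; apply: reaches_flow_solves CC' C't.
Qed.

End Trees.

(** * Flows in one direction *)

Section OneWayFlows.

Variables (I : finType) (prev : I -> I) (c : I -> nat).

(* [F i] steps leave [i], so [F (prev i)] pebbles arrive at [i]. *)
Definition one_way_flow (F : I -> nat) : Prop :=
  forall i, 2 * F i <= c i + F (prev i).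

(** At [i] the maximum is attained by a single flow, whose inflow is at most the maximal inflow. *)
Lemma one_way_flow_max (J : finType) (F : J -> I -> nat) :
  (forall j, one_way_flow (F j)) -> one_way_flow (fun i => \max_j F j i).
Proof.
move=> F_flow i; have [j0|J0] := pickP (fun _ : J => true).
  have [j -> _] := @eq_bigmax J (F^~ i) (introT card_gt0P (ex_intro _ j0 isT)).
  apply: leq_trans (F_flow j i) _; rewrite leq_add2l.
  exact: (leq_bigmax (F := fun j => F j (prev i))).
by rewrite big_pred0.
Qed.

(* With [h r = 2 r] for [r >= 2] and [h r = 0] otherwise, the potential of [i] is
   [h] of the number of pebbles that pass through [i]. *)
Lemma one_way_flow_reached (F : I -> nat) : injective prev -> one_way_flow F ->
  4 * \sum_i ((c i == 0) && (0 < F (prev i))) <= \sum_i (3 * c i - 2).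
Proof.
move=> inj_prev F_flow.
pose pot i := (c i + F (prev i)) * (if 1 < c i + F (prev i) then 2 else 0).
(* The total potential is added to both sides, shifted by [prev] on the right; the inequality then
   holds term by term. *)
rewrite -(leq_add2r (\sum_i pot i)) [X in _ <= _ + X](reindex_inj inj_prev).
rewrite big_distrr /= -!big_split /=; apply: leq_sum => i _.
have := F_flow (prev i); rewrite /pot; move: (c _ + F (prev (prev i))) => r.
move: (F (prev i)) (c i) => f k.
by do 2 case: ifP => ?; case: eqP => ?; case: (posnP f) => ?; lia.
Qed.

End OneWayFlows.

(** * Cycles *)

Section Cycles.

Variables (G : sgraph) (n : nat) (f : 'I_n -> G).
Hypotheses (n_gt2 : 2 < n) (bij_f : bijective f).
Hypothesis adj_f :
  forall i j : 'I_n, adj (f i) (f j) = (j == ordS i) || (i == ordS j).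
Implicit Types (C : config G) (i j : 'I_n).

Lemma ordS_neq_pred i : ord_pred i != ordS i.
Proof.
apply/eqP => /(congr1 (@nat_of_ord n)) /=.
have i_lt := ltn_ord i.
case: (posnP i) => [->|i_gt0].
  by rewrite (@modn_small 1) ?(@modn_small (0 + n).-1); lia.
have -> : (i + n).-1 = i.-1 + n by lia.
rewrite modnDr modn_small; last by lia.
have [i1|?] := ltnP i.+1 n; first by rewrite modn_small //; lia.
have -> : i.+1 = n by lia.
by rewrite modnn; lia.
Qed.

Lemma sum_neighbors (g : G -> nat) i :
  (forall w, 0 < g w -> adj (f i) w) ->
  \sum_w g w = g (f (ordS i)) + g (f (ord_pred i)).
Proof.
move=> g_adj; rewrite (reindex f) /=; last exact: onW_bij.
rewrite (bigD1 (ordS i)) //= (bigD1 (ord_pred i)) ?ordS_neq_pred //=.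
rewrite big1 ?addn0 // => j /andP[jS jP].
case: (posnP (g (f j))) => // /g_adj; rewrite adj_f (negbTE jS) /=.
by move=> /eqP iS; move: jP; rewrite iS ordSK eqxx.
Qed.

Lemma flow_solves_one_way C i : flow_solves C (f i) ->
  exists a b : 'I_n -> nat,
  [/\ one_way_flow (@ord_pred n) (C \o f) a,
      one_way_flow (@ordS n) (C \o f) b &
      C (f i) = 0 -> 0 < a (ord_pred i) \/ 0 < b (ordS i)].
Proof.
move=> [s [s_adj s_bal]].
have bal j : 2 * (s (f j) (f (ordS j)) + s (f j) (f (ord_pred j))) + (j == i)
    <= C (f j) + (s (f (ordS j)) (f j) + s (f (ord_pred j)) (f j)).
  have := s_bal (f j); rewrite (bij_eq bij_f).
  rewrite (@sum_neighbors (s (f j)) j); last by move=> w; apply: s_adj.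
  rewrite (@sum_neighbors (s^~ (f j)) j) // => w.
  by rewrite adj_sym; apply: s_adj.
(* Only the net flow of each edge is kept; truncated subtraction makes it zero in the weaker
   direction. *)
exists (fun j => s (f j) (f (ordS j)) - s (f (ordS j)) (f j)).
exists (fun j => s (f j) (f (ord_pred j)) - s (f (ord_pred j)) (f j)).
split=> [j|j|].
- by have := bal j; rewrite /= ord_predK; lia.
- by have := bal j; rewrite /= ordSK; lia.
- move=> Ci; have := bal i; rewrite ord_predK ordSK eqxx Ci.
  by rewrite /=; lia.
Qed.

Lemma cycle_solvable_csize C : solvable C -> 2 * n <= 3 * csize C.
Proof.
move=> sol.
have one_way i := flow_solves_one_way (i := i)
  (let: ex_intro C' (conj CC' C't) := sol (f i) in reaches_flow_solves CC' C't).
have [a /fin_all_exists[b ab]] := fin_all_exists one_way.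
pose F j := \max_i a i j; pose H j := \max_i b i j.
have F_flow : one_way_flow (@ord_pred n) (C \o f) F.
  by apply: one_way_flow_max => i; case: (ab i).
have H_flow : one_way_flow (@ordS n) (C \o f) H.
  by apply: one_way_flow_max => i; case: (ab i).
have := one_way_flow_reached (can_inj (@ord_predK n)) F_flow.
have := one_way_flow_reached (can_inj (@ordSK n)) H_flow.
have -> : csize C = \sum_i C (f i).
  by rewrite /csize (reindex f) //; apply: onW_bij.
have cover : n <= \sum_(i < n) (0 < C (f i)) +
    \sum_i ((C (f i) == 0) && (0 < F (ord_pred i))) +
    \sum_i ((C (f i) == 0) && (0 < H (ordS i))).
  rewrite -{1}(card_ord n) -sum1_card -!big_split /=; apply: leq_sum => i _.
  case: (posnP (C (f i))) => //= Ci0; case: (ab i) => _ _ /(_ Ci0) [] gt0.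
    have -> // : 0 < F (ord_pred i).
    exact: leq_trans gt0 (leq_bigmax (F := fun j => a j (ord_pred i)) i).
  have -> : 0 < H (ordS i); last by rewrite addn1.
  exact: leq_trans gt0 (leq_bigmax (F := fun j => b j (ordS i)) i).
(* A pile of [k > 0] gives [4 + 2 * (3 * k - 2) = 6 * k], an empty vertex gives 0 by truncation.
   Four times [cover] then yields [4 * n <= 6 * csize C]. *)
have pay : 4 * \sum_(i < n) (0 < C (f i)) + 2 * \sum_(i < n) (3 * C (f i) - 2) =
    6 * \sum_(i < n) C (f i).
  by rewrite !big_distrr -big_split /=; apply: eq_bigr => i _; lia.
move=> /=; move: cover pay.
move: (\sum_i (0 < C (f i))) (\sum_i (3 * C (f i) - 2)) (\sum_i C (f i)).
move: (\sum_i (_ && (0 < F _))) (\sum_i (_ && (0 < H _))).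
by lia.
Qed.

(** If [n] is 1 mod 3, the neighbours of the last vertex have residues 2 and 0, so it needs a cop of
    its own. *)
Definition third_vertices : 'I_n -> nat :=
  fun i => 2 * (i %% 3 == 1) + ((i %% 3 == 0) && (i.+1 == n)).

Lemma sum_third_vertices : 3 * \sum_i third_vertices i <= 2 * n + 2.
Proof.
have pairs m : \sum_(i < m) 2 * (i %% 3 == 1) = 2 * (m.+1 %/ 3).
  elim: m => [|m IHm]; first by rewrite big_ord0.
  by rewrite big_ord_recr /= IHm; lia.
have last : \sum_(i < n) ((i %% 3 == 0) && (i.+1 == n)) <= (n %% 3 == 1).
  move: n_gt2; case: n => // m _; rewrite big_ord_recr /= big1 => [|i _].
    by rewrite eqxx; lia.
  by rewrite eqSS (ltn_eqF (ltn_ord i)) andbF.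
rewrite /third_vertices big_split /= pairs.
by move: last; move: (\sum_(i < n) (_ && _)) => m; lia.
Qed.

Lemma third_vertices_dominate i : third_vertices i = 0 ->
  third_vertices (ordS i) = 2 \/ third_vertices (ord_pred i) = 2.
Proof.
rewrite /third_vertices => i0; have i_lt := ltn_ord i.
(* An empty vertex of residue 0 is not the last one, so its successor does not wrap around. *)
have [i_mod|i_mod] : i %% 3 = 0 \/ i %% 3 = 2 by lia.
  left => /=; rewrite (@modn_small i.+1); last by lia.
  by lia.
right => /=; have -> : (i + n).-1 = i.-1 + n by lia.
by rewrite modnDr (@modn_small i.-1); lia.
Qed.

Lemma cycle_cop_winning :
  exists C, cop_winning C /\ 3 * csize C <= 2 * n + 2.
Proof.
have [g fK gK] := bij_f.
exists [ffun w => third_vertices (g w)]; split; last first.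
  rewrite /csize (reindex f) /=; last exact: onW_bij.
  by under eq_bigr do rewrite ffunE fK; apply: sum_third_vertices.
move=> r; rewrite -(gK r); set i := g r.
set C : config G := finfun _.
have CE j : C (f j) = third_vertices j by rewrite ffunE fK.
case: (posnP (third_vertices i)) => [i0|]; last first.
  by rewrite -CE; apply: cops_win_captured.
have [j ji Cj] : exists2 j, adj (f j) (f i) & 2 <= C (f j).
  case: (third_vertices_dominate i0) => Cj.
    by exists (ordS i); rewrite ?CE ?Cj // adj_f eqxx orbT.
  by exists (ord_pred i); rewrite ?CE ?Cj // adj_f ord_predK eqxx.
pose C' : config G := [ffun w => C w - 2 * (w == f j) + (w == f i)].
apply: (@cops_win_catch _ _ C').
  by apply: step_cop_turn; exists (f j), (f i).
by rewrite ffunE eqxx addn1.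
Qed.

End Cycles.

Theorem theorem2 (G : sgraph) :
  optimal_pebbling_number G <= cop_pebbling_number G /\
  (is_tree G \/ is_cycle G ->
   cop_pebbling_number G = optimal_pebbling_number G).
Proof.
rewrite /optimal_pebbling_number /cop_pebbling_number.
case: ex_minnP => m /asboolP[C [C_m C_sol]] m_min.
case: ex_minnP => k /asboolP[K [K_k K_win]] k_min.
have m_k : m <= k.
  apply: m_min; apply/asboolP; exists K; split=> //.
  exact: cop_winning_solvable.
split=> // tree_or_cycle; apply/eqP; rewrite eqn_leq m_k andbT.
suff [C' [C'_win C'_m]] : exists C' : config G, cop_winning C' /\ csize C' <= m.
  by apply: leq_trans C'_m; apply: k_min; apply/asboolP; exists C'.
case: tree_or_cycle => [treeG|[n [n_gt2 [f [bij_f adj_f]]]]].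
  by exists C; rewrite C_m; split=> //; apply: tree_solvable_cop_winning.
have [C' [C'_win C'_n]] := cycle_cop_winning n_gt2 bij_f adj_f.
exists C'; split=> //.
(* Both bounds together give [3 * csize C' <= 3 * m + 2], and integrality removes the excess. *)
by have := cycle_solvable_csize n_gt2 bij_f adj_f C_sol; lia.
Qed.
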